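(* Let $\mathbf p$ be a probability vector (not necessarily uniform). Suppose that $A$ is an irreducible $N\times N$ stochastic matrix such that the one-sided Markov shift $X_A^-$ is a $\mathbf p$-endomorphism and such that for every pair of rows of $A$ one can find two identical nonzero entries in the same column (i.e. for all $i,j$ there is a column $k$ with $A_{ik}=A_{jk}\neq 0$). Then $X_A^-$ is tvwB.
   Context: **Measure-preserving systems.** A measure-preserving system (m.p.s.) is a quadruple $(X,\mathcal B,\mu,T)$ where $X$ is a compact metric space with Borel $\sigma$-algebra $\mathcal B$, $(X,\mathcal B,\mu)$ is a nonatomic Lebesgue probability space (isomorphic to $[0,1]$ with Lebesgue measure), and $T:X\to X$ is measurable with $\mu(T^{-1}B)=\mu(B)$ for $B\in\mathcal B$. **$\mathbf p$-endomorphisms.** For a probability vector $\mathbf p=(p_1,\dots,p_s)$ with all $p_j>0$, let $h(\mathbf p)=-\sum_j p_j\log_2 p_j$. An m.p.s. $(X,\mathcal B,\mu,T)$ is a $\mathbf p$-endomorphism if $T$ is $s$-to-1 a.e., for a.a. $x$ the conditional probabilities (given $x$) of the $s$ preimages of $x$ under $T$ are the components of $\mathbf p$ (with multiplicity), and its entropy is $h(\mathbf p)$. **One-sided Markov shifts.** A square matrix $A$ with nonnegative entries is stochastic if each row sums to $1$; $|A|$ is its number of rows; it is irreducible if for each $(i,j)$ some $(A^k)_{ij}$, $k\in\mathbf N$, is nonzero. For irreducible $A$ let $\mathbf q$ be the unique positive row probability vector with $\mathbf qA=\mathbf q$. The one-sided Markov shift $X_A^-$ over $A$ is $\{1,\dots,|A|\}^{-\mathbf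 N}$ (left-infinite sequences $(\ldots,x_{-2},x_{-1})$) with the shift $T$, $(Tx)_{-n}=x_{-n-1}$, and the shift-invariant Borel measure $\mu$ determined by $\mu(x_{-n}=a_{-n},\dots,x_{-1}=a_{-1})=q_{a_{-n}}A_{a_{-n}a_{-(n-1)}}\cdots A_{a_{-2}a_{-1}}$. **Trees.** $\mathcal T$ is the set of all finite sequences (nodes) of elements of $\{1,\dots,s\}$, including the empty one; $|v|$ is the length of $v$; $\mathcal T'$ is the set of nonempty nodes; $\mathcal T_N=\{v:|v|\le N\}$, $\mathcal T_N'=\{v:0<|v|\le N\}$. $\sigma:\mathcal T'\to\mathcal T$ deletes the leftmost symbol. The weight of $v=(a_1,\dots,a_j)$ is $w_v=\prod_i p_{a_i}$ (and $1$ for the empty node). A tree automorphism is a bijection $B:\mathcal T\to\mathcal T$ with $B\sigma(v)=\sigma B(v)$ and $w_{Bv}=w_v$ for all $v\in\mathcal T'$; $\mathcal A_N$ is the set of restrictions of tree automorphisms to $\mathcal T_N$. For a compact metric space $(R,d)$ and functions $h,h'$ into $R$ defined on $\mathcal T_N'$ (or on $\mathcal T'$), $$\bar t_N(h,h')=\frac1N\inf_{B\in\mathcal A_N}\sum_{0<|v|\le N}w_v\,d(h(v),h'(Bv)).$$ **Tree names.** A tree partition of a $\mathbf p$-endomorphism is a measurable $K:X\to\{1,\dots,s\}$ such that for a.a. $x$ the $s$ preimages of $x$ have distinct $K$-values and the preimage with $K$-value $j$ has conditional probability $p_j$. Fix one. For $j\in\{1,\dots,s\}$, $T_jx$ is the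 preimage of $x$ with $K$-value $j$; for $v=(a_1,\dots,a_n)$, $T_vx=T_{a_1}(T_{a_2}\cdots(T_{a_n}x)\cdots)$. For $g:X\to R$ the $g$-tree name of $x$ is $\tau_x^g:\mathcal T'\to R$, $\tau_x^g(v)=g(T_vx)$. **tvwB.** For a $\mathbf p$-endomorphism $\mathbf X$ and a measurable $g:X\to R$ into a compact metric space, $(\mathbf X,g)$ is tvwB (tree very weak Bernoulli) if for every $\varepsilon>0$ there is $N$ such that for every $n\ge N$ there is a set $G\subseteq X$ of measure at least $1-\varepsilon$ with $\bar t_n(\tau_x^g,\tau_y^g)<\varepsilon$ for all $x,y\in G$ (independent of the choice of $K$). $\mathbf X$ is tvwB if $(\mathbf X,g)$ is tvwB for every compact metric space $R$ and every measurable $g:X\to R$. *)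

(* Defs.v *)
From HB Require Import structures.
From mathcomp Require Import all_boot all_order all_algebra.
From mathcomp Require Import all_classical all_reals all_analysis.
Set Implicit Arguments.
Unset Strict Implicit.
Unset Printing Implicit Defensive.
Import Order.TTheory GRing.Theory Num.Theory.
Import numFieldNormedType.Exports.
Local Open Scope classical_set_scope.
Local Open Scope ring_scope.

Notation borel X := (g_sigma_algebraType (@open X)).

Definition metrizable (R : realType) (X : topologicalType) : Prop :=
  exists d : X -> X -> R,
    [/\ forall x y, d x y = 0 <-> x = y,
        forall x y, d x y = d y x,
        forall x y z, d x z <= d x y + d y z
      & forall x (U : set X), nbhs x U <->
          exists2 e : R, 0 < e & [set y | d x y < e] `<=` U].

(* Isomorphic modulo null sets to [0, 1] with Lebesgue measure. *)
Definition nonatomic_lebesgue_space (R : realType) (X : ptopologicalType)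
    (mu : probability (borel X) R) : Prop :=
  exists (X0 : set (borel X)) (Y0 : set (measurableTypeR R))
      (f : borel X -> measurableTypeR R) (g : measurableTypeR R -> borel X),
    [/\ [/\ measurable X0, mu X0 = 1%E, measurable Y0, Y0 `<=` `[0, 1]
          & lebesgue_measure Y0 = 1%E],
        measurable_fun X0 f, measurable_fun Y0 g,
        (forall x, X0 x -> Y0 (f x) /\ g (f x) = x) /\
        (forall y, Y0 y -> X0 (g y) /\ f (g y) = y)
      & forall B : set (measurableTypeR R), measurable B ->
          mu (X0 `&` f @^-1` B) = lebesgue_measure (Y0 `&` B)].

Definition mps (R : realType) (X : ptopologicalType)
    (mu : probability (borel X) R) (T : X -> X) : Prop :=
  [/\ compact [set: X], metrizable R X, nonatomic_lebesgue_space mu,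
      measurable_fun [set: borel X] (T : borel X -> borel X)
    & forall B : set (borel X), measurable B -> mu (T @^-1` B) = mu B].

Definition log2 (R : realType) (x : R) : R := ln x / ln 2.

Definition prob_vector (R : realType) (s : nat) (p : 'I_s -> R) : Prop :=
  (forall j, 0 < p j) /\ \sum_j p j = 1.

Definition vector_entropy (R : realType) (s : nat) (p : 'I_s -> R) : R :=
  - \sum_j p j * log2 (p j).

(* A finite measurable partition is encoded by its labelling xi : X -> 'I_m. *)
Definition finite_measurable (X : ptopologicalType) (m : nat)
    (xi : X -> 'I_m) : Prop :=
  forall i, measurable (xi @^-1` [set i] : set (borel X)).

(* Entropy of the join of xi, T^-1 xi, ..., T^-(n-1) xi. *)
Definition join_entropy (R : realType) (X : ptopologicalType)
    (mu : probability (borel X) R) (T : X -> X) (m : nat) (xi : X -> 'I_m)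
    (n : nat) : R :=
  - \sum_(a : {ffun 'I_n -> 'I_m})
      let c := fine (mu [set x | forall i : 'I_n, xi (iter i T x) = a i]) in
      c * log2 c.

Definition partition_entropy (R : realType) (X : ptopologicalType)
    (mu : probability (borel X) R) (T : X -> X) (m : nat) (xi : X -> 'I_m) : R :=
  lim ((fun n : nat => join_entropy mu T xi n / n%:R) @ \oo).

Definition entropy (R : realType) (X : ptopologicalType)
    (mu : probability (borel X) R) (T : X -> X) : \bar R :=
  ereal_sup [set h | exists m (xi : X -> 'I_m),
    finite_measurable xi /\ h = (partition_entropy mu T xi)%:E].

(* k x is a version, unique for almost all x, of the conditional distribution
   of a point given that its image under T is x. *)
Definition disintegration (R : realType) (X : ptopologicalType)
    (mu : probability (borel X) R) (T : X -> X)
    (k : R.-pker (borel X) ~> (borel X)) : Prop :=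
  forall A B : set (borel X), measurable A -> measurable B ->
    mu (A `&` T @^-1` B) = (\int[mu]_(x in B) k x A)%E.

(* Preimages are counted modulo null sets: points of the fibre with zero
   conditional probability are discarded.  For a Markov shift over A this
   discards the forbidden transitions, i.e. the zero entries of A. *)
Definition preimages (R : realType) (X : ptopologicalType) (T : X -> X)
    (k : R.-pker (borel X) ~> (borel X)) (x : X) : set X :=
  [set y | T y = x /\ (0 < k x [set y])%E].

Definition p_endomorphism (R : realType) (X : ptopologicalType) (s : nat)
    (p : 'I_s -> R) (mu : probability (borel X) R) (T : X -> X) : Prop :=
  [/\ mps mu T,
      exists2 k : R.-pker (borel X) ~> (borel X), disintegration mu T k &
        {ae mu, forall x, exists y : 'I_s -> X,
          [/\ injective y, preimages T k x = range y
            & forall j, k x [set y j] = (p j)%:E]}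
    & entropy mu T = (vector_entropy p)%:E].

Definition stochastic (R : realType) (n : nat) (A : 'M[R]_n) : Prop :=
  (forall i j, 0 <= A i j) /\ (forall i, \sum_j A i j = 1).

Definition irreducible_mx (R : realType) (n : nat) (A : 'M[R]_n) : Prop :=
  forall i j, exists k : nat, (A ^+ k.+1) i j != 0.

Definition stationary (R : realType) (n : nat) (A : 'M[R]_n) (q : 'rV[R]_n) :
    Prop :=
  [/\ forall i, 0 < q 0 i, \sum_i q 0 i = 1 & q *m A = q].

(* Left-infinite sequences over N.+1 symbols; x n stands for x_{-(n+1)}. *)
Definition left_sequences (N : nat) : Type :=
  prod_topology (fun _ : nat => discrete_topology 'I_N.+1).

HB.instance Definition _ (N : nat) := Topological.on (left_sequences N).
HB.instance Definition _ (N : nat) :=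
  isPointed.Build (left_sequences N) (fun=> ord0).

Definition left_shift (N : nat) (x : left_sequences N) : left_sequences N :=
  fun n => x n.+1.

Definition markov_measure (R : realType) (N : nat) (A : 'M[R]_N.+1)
    (mu : probability (borel (left_sequences N)) R) : Prop :=
  exists2 q : 'rV[R]_N.+1, stationary A q &
    forall (n : nat) (a : nat -> 'I_N.+1),
      mu [set x | forall i, (i <= n)%N -> x i = a i] =
      (q 0 (a n) * \prod_(i < n) A (a i.+1) (a i))%:E.

Definition weight (R : realType) (s : nat) (p : 'I_s -> R) (v : seq 'I_s) : R :=
  \prod_(a <- v) p a.

(* The deletion of the leftmost symbol is behead.  Bijectivity forces B to map
   nonempty nodes to nonempty nodes, so the value behead [::] = [::] causes no
   loss; B then also preserves lengths. *)
Definition tree_automorphism (R : realType) (s : nat) (p : 'I_s -> R)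
    (B : seq 'I_s -> seq 'I_s) : Prop :=
  bijective B /\
  forall v, v != [::] ->
    B (behead v) = behead (B v) /\ weight p (B v) = weight p v.

(* The sum depends only on the restriction of B to nodes of length <= n, so
   the infimum may be taken over automorphisms of the whole tree. *)
Definition tbar (R : realType) (s : nat) (p : 'I_s -> R) (M : metricType R)
    (n : nat) (h h' : seq 'I_s -> M) : R :=
  n%:R^-1 *
  inf [set \sum_(1 <= l < n.+1) \sum_(v : l.-tuple 'I_s)
             weight p v * mdist (h v) (h' (B v))
      | B in tree_automorphism p].

Definition tree_partition (R : realType) (X : ptopologicalType) (s : nat)
    (p : 'I_s -> R) (mu : probability (borel X) R) (T : X -> X)
    (k : R.-pker (borel X) ~> (borel X)) (K : X -> 'I_s) : Prop :=
  [/\ disintegration mu T k, finite_measurable K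
    & {ae mu, forall x, set_bij (preimages T k x) [set: 'I_s] K /\
        forall y, preimages T k x y -> k x [set y] = (p (K y))%:E}].

(* The preimage of x with K-value j; x itself is a dummy value, used only on
   the null set where there is no such preimage. *)
Definition branch (R : realType) (X : ptopologicalType) (s : nat) (T : X -> X)
    (k : R.-pker (borel X) ~> (borel X)) (K : X -> 'I_s) (j : 'I_s) (x : X) : X :=
  xget x [set y | preimages T k x y /\ K y = j].

Definition tree_name (R : realType) (X : ptopologicalType) (s : nat)
    (T : X -> X) (k : R.-pker (borel X) ~> (borel X)) (K : X -> 'I_s) (M : Type)
    (g : X -> M) (x : X) (v : seq 'I_s) : M :=
  g (foldr (branch T k K) x v).

(* The condition does not depend on the tree partition: it is required of all
   of them, and the first clause rules out vacuity. *)
Definition tvwB_fun (R : realType) (X : ptopologicalType) (s : nat)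
    (p : 'I_s -> R) (mu : probability (borel X) R) (T : X -> X)
    (M : metricType R) (g : X -> M) : Prop :=
  (exists k K, tree_partition p mu T k K) /\
  forall k K, tree_partition p mu T k K ->
    forall eps : R, 0 < eps -> exists n0 : nat, forall n : nat, (n0 <= n)%N ->
      exists G : set (borel X),
        [/\ measurable G, ((1 - eps)%:E <= mu G)%E
          & forall x y, G x -> G y ->
              tbar p n (tree_name T k K g x) (tree_name T k K g y) < eps].

Definition tvwB (R : realType) (X : ptopologicalType) (s : nat)
    (p : 'I_s -> R) (mu : probability (borel X) R) (T : X -> X) : Prop :=
  forall (M : metricType R) (g : X -> M), compact [set: M] ->
    (forall B : set M, <<s @open M >> B ->
       measurable (g @^-1` B : set (borel X))) ->
    tvwB_fun p mu T g.

(* Main.v *)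
Require Import Defs.
From HB Require Import structures.
From mathcomp Require Import all_boot all_order all_algebra perm.
From mathcomp Require Import all_classical all_reals all_analysis.
From mathcomp Require Import measurable_realfun ring.

(* Match the preimage trees of two points x and y one generation at a time.  At
   a pair of nodes with the same symbol, send each child to the child with the
   same symbol; at a pair with different symbols, the column hypothesis gives
   one child of each with the same symbol and the same weight, and these two are
   matched.  Since matched pairs stay matched, the weight of the unmatched nodes
   of level l is at most (1 - min p)^l, so on average the paired points agree on
   many coordinates.  By regularity of the measure, g is determined up to a
   small error by finitely many coordinates outside a set E of small measure.
   The shift invariance of the measure makes the expected weight of the nodes in
   E equal to mu(E) at every level, so Markov's inequality bounds it for all x
   in a large set. *)

Set Implicit Arguments.
Unset Strict Implicit.
Unset Printing Implicit Defensive.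
Import Order.TTheory GRing.Theory Num.Theory.
Import numFieldNormedType.Exports.
Local Open Scope classical_set_scope.
Local Open Scope ring_scope.

(** * Weighted sums over the levels of the tree *)

(** For a probability vector [p] this is the expectation of [F] at a random node of level [l] with
    independent symbols of law [p]. *)
Definition level_sum (R : realType) (s : nat) (p : 'I_s -> R) (l : nat)
    (F : seq 'I_s -> R) : R :=
  \sum_(v : l.-tuple 'I_s) weight p v * F v.

Lemma weight_cons (R : realType) (s : nat) (p : 'I_s -> R) a v :
  weight p (a :: v) = p a * weight p v.
Proof. by rewrite /weight big_cons. Qed.

Lemma weight_ge0 (R : realType) (s : nat) (p : 'I_s -> R) v :
  (forall a, 0 <= p a) -> 0 <= weight p v.
Proof. by move=> p0; apply: prodr_ge0. Qed.

Lemma level_sum0 (R : realType) (s : nat) (p : 'I_s -> R) F :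
  level_sum p 0 F = F [::].
Proof.
rewrite /level_sum (big_pred1 [tuple])=> [|v]; last exact/esym/eqP/tuple0.
by rewrite /weight big_nil mul1r.
Qed.

(** The children of a node differ in their leftmost symbol, so one may first average over the
    children of each node of the previous level. *)
Lemma level_sumS (R : realType) (s : nat) (p : 'I_s -> R) l F :
  level_sum p l.+1 F = level_sum p l (fun v => \sum_a p a * F (a :: v)).
Proof.
rewrite /level_sum.
pose h (u : l.-tuple 'I_s * 'I_s) : l.+1.-tuple 'I_s := cons_tuple u.2 u.1.
rewrite (reindex h) /=; last first.
  exists (fun t => (behead_tuple t, thead t)) => [[v a] _|t _] /=.
    by congr pair; apply/val_inj.
  by rewrite /h /= [RHS]tuple_eta; apply/val_inj.
rewrite -(pair_big xpredT xpredT
  (fun v a => weight p (h (v, a)) * F (h (v, a)))) /=.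
apply: eq_bigr => v _; rewrite big_distrr /=; apply: eq_bigr => a _.
by rewrite weight_cons mulrCA mulrA.
Qed.

Lemma eq_level_sum (R : realType) (s : nat) (p : 'I_s -> R) l F G :
  (forall v, size v = l -> F v = G v) -> level_sum p l F = level_sum p l G.
Proof. by move=> FG; apply: eq_bigr => v _; rewrite FG ?size_tuple. Qed.

Lemma level_sumD (R : realType) (s : nat) (p : 'I_s -> R) l F G :
  level_sum p l (fun v => F v + G v) = level_sum p l F + level_sum p l G.
Proof. by rewrite -big_split /=; apply: eq_bigr => v _; rewrite mulrDr. Qed.

Lemma level_sumZ (R : realType) (s : nat) (p : 'I_s -> R) l c F :
  level_sum p l (fun v => c * F v) = c * level_sum p l F.
Proof. by rewrite /level_sum mulr_sumr; apply: eq_bigr => v _; rewrite mulrCA. Qed.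

Lemma ler_level_sum (R : realType) (s : nat) (p : 'I_s -> R) l F G :
  (forall a, 0 <= p a) -> (forall v, size v = l -> F v <= G v) ->
  level_sum p l F <= level_sum p l G.
Proof.
move=> p0 FG; apply: ler_sum => v _.
by rewrite ler_wpM2l ?weight_ge0 ?FG ?size_tuple.
Qed.

Lemma level_sum_cst (R : realType) (s : nat) (p : 'I_s -> R) l c :
  \sum_a p a = 1 -> level_sum p l (fun=> c) = c.
Proof.
move=> p1; elim: l => [|l IH]; first by rewrite level_sum0.
by rewrite level_sumS -mulr_suml p1 mul1r.
Qed.

(** [drop m v] is the ancestor of [v] lying [m] generations nearer the root; the [m] newest symbols
    average out. *)
Lemma level_sum_drop (R : realType) (s : nat) (p : 'I_s -> R) m l F :
  \sum_a p a = 1 ->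
  level_sum p (m + l) (fun v => F (drop m v)) = level_sum p l F.
Proof.
move=> p1; elim: m => [|m IH]; first by under eq_level_sum do rewrite drop0.
rewrite addSn level_sumS -[RHS]IH; apply: eq_level_sum => v _ /=.
by rewrite -mulr_suml p1 mul1r.
Qed.

Lemma level_sum_inj (R : realType) (s : nat) (p : 'I_s -> R) l B F :
  injective B -> (forall v, size (B v) = size v) ->
  (forall v, weight p (B v) = weight p v) ->
  level_sum p l (fun v => F (B v)) = level_sum p l F.
Proof.
move=> Binj Bsize Bw.
have BP (v : l.-tuple 'I_s) : size (B v) == l by rewrite Bsize size_tuple.
pose h (v : l.-tuple 'I_s) := Tuple (BP v).
have hinj : injective h by move=> u v /(congr1 val)/Binj/val_inj.
rewrite /level_sum [RHS](reindex h); last exact/onW_bij/injF_bij.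
by apply: eq_bigr => v _ /=; rewrite Bw.
Qed.

(** * Automorphisms that match two labelled trees *)

(** [B] is built outwards from the root: once [B v] is known, the permutation chosen for the pair of
    [v] and [B v] sends the children of [v] to those of [B v]. The hypothesis covers all pairs of
    nodes because [B v] is not known in advance. *)
Lemma coupling_automorphism (R : realType) (s : nat) (p : 'I_s -> R)
    (I : Type) (f f' : seq 'I_s -> I) :
  (forall v w, exists pi : {perm 'I_s}, [/\ forall a, p (pi a) = p a,
     f v = f' w -> forall a, f (a :: v) = f' (pi a :: w)
   & exists a, f (a :: v) = f' (pi a :: w)]) ->
  exists B, [/\ tree_automorphism p B,
    [/\ injective B, forall v, size (B v) = size v
      & forall v, weight p (B v) = weight p v],
    forall v a, f v = f' (B v) -> f (a :: v) = f' (B (a :: v))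
  & forall v, exists a, f (a :: v) = f' (B (a :: v))].
Proof.
move=> H; have /choice[pi Hpi] : forall u : seq 'I_s * seq 'I_s,
    exists pi : {perm 'I_s}, [/\ forall a, p (pi a) = p a,
       f u.1 = f' u.2 -> forall a, f (a :: u.1) = f' (pi a :: u.2)
     & exists a, f (a :: u.1) = f' (pi a :: u.2)] by move=> u; exact: H.
pose B := fix B v := if v is a :: v' then pi (v', B v') a :: B v' else [::].
(* The permutation to invert depends on the source node too, which is recovered as [C w']. *)
pose C := fix C w := if w is b :: w' then ((pi (C w', w'))^-1)%g b :: C w' else [::].
have BK : cancel B C by elim=> //= a v ->; rewrite permK.
have CK : cancel C B by elim=> //= a v ->; rewrite permKV.
have Bsize v : size (B v) = size v by elim: v => //= a v ->.
have Bw v : weight p (B v) = weight p v.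
  elim: v => //= a v IH; rewrite !weight_cons IH.
  by have [-> _ _] := Hpi (v, B v).
exists B; split => //.
- split; first by exists C.
  by case=> [//|a v] _; split.
- by split=> //; exact: can_inj BK.
- by move=> v a /= e; have [_ h _] := Hpi (v, B v); exact: h.
- by move=> v /=; have [_ _ [a e]] := Hpi (v, B v); exists a.
Qed.

(** A matched node has only matched children, and a mismatched one has a matched child of weight at
    least [delta]; each generation thus multiplies the mismatched weight by at most [1 - delta]. *)
Lemma mismatch_level_sum (R : realType) (s : nat) (p : 'I_s -> R)
    (I : eqType) (f g : seq 'I_s -> I) (delta : R) l :
  \sum_a p a = 1 -> (forall a, 0 <= p a) -> (forall a, delta <= p a) ->
  delta <= 1 ->
  (forall v a, f v = g v -> f (a :: v) = g (a :: v)) ->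
  (forall v, exists a, f (a :: v) = g (a :: v)) ->
  level_sum p l (fun v => (f v != g v)%:R) <= (1 - delta) ^+ l.
Proof.
move=> p1 p0 pd d1 fg ex; elim: l => [|l IH].
  by rewrite level_sum0 expr0; case: (_ != _).
rewrite level_sumS exprS.
apply: (@le_trans _ _ (level_sum p l (fun v => (1 - delta) * (f v != g v)%:R))).
  apply: ler_level_sum => // v _; have [e|ne] := eqVneq (f v) (g v).
    rewrite mulr0 big1// => a _; by rewrite (fg v a e) eqxx mulr0.
  have [a ea] := ex v; rewrite mulr1 (bigD1 a) //= ea eqxx mulr0 add0r.
  have -> : 1 - delta = p a - delta + \sum_(i < s | i != a) p i.
    by rewrite -p1 (bigD1 a) //= addrAC.
  apply: (@le_trans _ _ (\sum_(i < s | i != a) p i)); last first.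
    by rewrite lerDr subr_ge0.
  by apply: ler_sum => i _; rewrite ler_piMr //; case: (_ != _).
by rewrite level_sumZ ler_wpM2l // subr_ge0.
Qed.

(** * Cylinders, topology and Borel sets of the sequence space *)

Local Notation lseq N := (borel (left_sequences N)).

(** For fixed [x] this is the cylinder of length [m] around [x]; coordinate [0] is the newest
    one. *)
Definition agree (N m : nat) (x y : left_sequences N) : Prop :=
  forall i, (i < m)%N -> x i = y i.

Definition extend (N : nat) (c : 'I_N.+1) (x : left_sequences N) :
    left_sequences N :=
  fun n => if n is k.+1 then x k else c.

Lemma left_shift_extend N c (x : left_sequences N) :
  left_shift (extend c x) = x.
Proof. by []. Qed.

Lemma extend_left_shift N (x : left_sequences N) :
  extend (x 0) (left_shift x) = x.
Proof. by apply/funext => -[]. Qed.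

Lemma agree_sym N m (x y : left_sequences N) : agree m x y -> agree m y x.
Proof. by move=> xy i im; rewrite xy. Qed.

Lemma agree_trans N m (x y z : left_sequences N) :
  agree m x y -> agree m y z -> agree m x z.
Proof. by move=> xy yz i im; rewrite xy// yz. Qed.

Lemma agree_leq N m m' (x y : left_sequences N) :
  (m <= m')%N -> agree m' x y -> agree m x y.
Proof. by move=> mm' xy i im; rewrite xy// (leq_trans im). Qed.

Lemma agree_extend N m c (x y : left_sequences N) :
  agree m x y -> agree m.+1 (extend c x) (extend c y).
Proof. by move=> xy [//|i]; exact: xy. Qed.

Lemma nbhs_agree N (x : left_sequences N) m : nbhs x (agree m x).
Proof.
elim: m => [|m IH]; first by apply: filterS filterT.
have h : nbhs x [set y : left_sequences N | y m = x m].
  have c := @proj_continuous _ (fun _ : nat => discrete_topology 'I_N.+1) m.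
  by have := c x _ (@discrete_set1 (discrete_topology 'I_N.+1) (x m)).
apply: filterS (filterI IH h) => y [xy ym] i; rewrite ltnS leq_eqVlt.
by case/predU1P => [->|]; [rewrite ym|exact: xy].
Qed.

(** The filter generated by the cylinders around [x] converges to [x] in each coordinate, hence in
    the product topology, so every neighbourhood of [x] contains a cylinder. *)
Lemma open_leftP N (U : set (left_sequences N)) :
  open U <-> forall x, U x -> exists m, forall y, agree m x y -> U y.
Proof.
rewrite openE; split => UP x Ux; last first.
  by have [m mU] := UP x Ux; apply: filterS (nbhs_agree x m).
pose F : set_system (left_sequences N) :=
  filter_from [set: nat] (fun m => agree m x).
have FF : Filter F.
  apply: filter_from_filter; first by exists 0%N.
  move=> i j _ _; exists (maxn i j) => // y xy; split.
    by apply: agree_leq xy; exact: leq_maxl.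
  by apply: agree_leq xy; exact: leq_maxr.
have Fx : F --> x.
  apply/cvg_sup => i /= A [_ [[B oB <-] Bx BA]].
  exists i.+1 => // y xy; apply: BA; move: Bx; rewrite /= (xy i) //.
have [m _ mU] := Fx _ (UP x Ux).
by exists m.
Qed.

(** A set determined by finitely many coordinates is open. *)
Lemma measurable_agree_closed N m (U : set (lseq N)) :
  (forall x y, agree m x y -> U x -> U y) -> measurable U.
Proof.
move=> mU; apply: sub_sigma_algebra.
by apply/open_leftP => x Ux; exists m => y xy; exact: mU xy Ux.
Qed.

Lemma measurable_agree N m (x : left_sequences N) :
  measurable (agree m x : set (lseq N)).
Proof.
by apply: (@measurable_agree_closed _ m) => y z yz xy; exact: agree_trans yz.
Qed.

Definition starts N (i : 'I_N.+1) : set (lseq N) :=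
  [set x : left_sequences N | x 0%N = i].

Lemma measurable_starts N (i : 'I_N.+1) : measurable (starts i).
Proof.
by apply: (@measurable_agree_closed _ 1) => x y xy; rewrite /starts /= xy.
Qed.

Lemma measurable_extend N (c : 'I_N.+1) :
  measurable_fun [set: lseq N]
    (extend c : _ -> lseq N).
Proof.
apply: (@measurability _ _ (lseq N) (lseq N) _ _ (@open (left_sequences N)) erefl).
move=> _ [U oU <-].
rewrite setTI; apply: sub_sigma_algebra; apply/open_leftP => x Ux.
have [m mU] := (open_leftP U).1 oU _ Ux.
exists m => y xy; apply: mU; apply: agree_leq (agree_extend c xy).
exact: leqnSn.
Qed.

Lemma measurable_left_shift N :
  measurable_fun [set: lseq N]
    (@left_shift N : _ -> lseq N).
Proof.
apply: (@measurability _ _ (lseq N) (lseq N) _ _ (@open (left_sequences N)) erefl).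
move=> _ [U oU <-].
rewrite setTI; apply: sub_sigma_algebra; apply/open_leftP => x Ux.
have [m mU] := (open_leftP U).1 oU _ Ux.
by exists m.+1 => y xy; apply: mU => i im; apply: xy.
Qed.

(** Indexing cylinders by finite words exhibits them as a countable family. *)
Definition prefix_cylinder (N : nat) (t : seq 'I_N.+1) : set (left_sequences N) :=
  agree (size t) (fun n => nth ord0 t n).

(** The empty set is included to make the family stable under intersection: two cylinders are nested
    or disjoint. *)
Definition cylinders N : set (set (left_sequences N)) :=
  [set B | B = set0 \/ exists m x, B = agree m x].

Lemma agree_prefix_cylinder N m (x : left_sequences N) :
  prefix_cylinder (mkseq x m) = agree m x.
Proof.
rewrite /prefix_cylinder size_mkseq; apply/seteqP.
by split=> y + i im => /(_ i im); rewrite nth_mkseq.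
Qed.

Lemma setI_closed_cylinders N : setI_closed (@cylinders N).
Proof.
move=> B C [->|[m [x ->]]]; first by rewrite set0I; left.
case=> [->|[n [y ->]]]; first by rewrite setI0; left.
wlog mn : m n x y / (m <= n)%N => [hwlog|].
  by have [/hwlog|/ltnW/hwlog] := leqP m n; [exact|rewrite setIC; exact].
have [xy|nxy] := pselect (agree m y x); last first.
  left; rewrite -subset0 => z [xz yz]; apply: nxy.
  exact: agree_trans (agree_leq mn yz) (agree_sym xz).
right; exists n, y; apply/seteqP; split=> [z []//|z yz]; split=> //.
exact: agree_trans (agree_sym xy) (agree_leq mn yz).
Qed.

(** An open set is the union of the cylinders it contains, and there are only countably many finite
    words. *)
Lemma borel_cylinders N :
  @measurable _ (lseq N) = <<s @cylinders N >>.
Proof.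
apply/seteqP; split; last first.
  apply: smallest_sub; first exact: sigma_algebra_measurable.
  by move=> B [->|[m [x ->]]]; [exact: measurable0|exact: measurable_agree].
apply: smallest_sub; first exact: smallest_sigma_algebra.
move=> U /open_leftP oU.
have -> : U = \bigcup_(t in [set: seq 'I_N.+1])
    if `[< prefix_cylinder t `<=` U >] then prefix_cylinder t else set0.
  apply/seteqP; split=> [x Ux|x [t _]]; last by case: asboolP => // tU /tU.
  have [m mU] := oU x Ux; exists (mkseq x m) => //.
  by rewrite agree_prefix_cylinder; case: asboolP => // h; exfalso; exact: h.
apply: (@countable_bigcupT_measurable _ (g_sigma_algebraType (@cylinders N))) => //.
move=> t; apply: sub_sigma_algebra; case: ifP => _; last by left.
by right; exists (size t), (fun n => nth ord0 t n).
Qed.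

(* Indices grow towards the past: [A i c] is the conditional probability that
   [x 0 = c] given [x 1 = i]. *)
Lemma markov_shift (R : realType) (N : nat) (A : 'M[R]_N.+1)
    (mu : probability (lseq N) R) :
  (forall i j, 0 <= A i j) -> markov_measure A mu ->
  forall c i (B : set (lseq N)), measurable B ->
  mu (@left_shift N @^-1` (B `&` starts i) `&` starts c) =
  ((A i c)%:E * mu (B `&` starts i))%E.
Proof.
move=> A0 [q _ hmu] c i.
have mc := measurable_starts c.
have mi := measurable_starts i.
have mT := @measurable_left_shift N.
have mci : measurable (@left_shift N @^-1` starts i `&` starts c : set (lseq N)).
  by apply: measurableI => //; rewrite -[X in measurable X]setTI; exact: mT.
(* Both sides are finite measures in [B], so it suffices to compare them on cylinders. *)
pose m1 := pushforward (mrestr mu mci) (@left_shift N : _ -> lseq N).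
pose m1' : {measure set (lseq N) -> \bar R} := m1.
pose m2 := mscale (NngNum (A0 i c)) (mrestr mu mi).
suff h B : measurable B -> m1 B = m2 B.
  move=> B mB; have := h B mB.
  by rewrite /m1 /m2 /pushforward /mscale /mrestr /= preimage_setI setIA.
refine (@measure_unique _ R (lseq N) (@cylinders N) (fun=> setT) _ _ _ _
  (m1' mT) m2 _ _ B).
- exact: borel_cylinders.
- exact: setI_closed_cylinders.
- by move=> _; right; exists 0%N, point; apply/seteqP; split.
- by rewrite bigcup_const //; exists 0%N.
- move=> {}B cB; change (m1 B = m2 B).
  have -> : m1 B = mu (@left_shift N @^-1` (B `&` starts i) `&` starts c).
    by rewrite /m1 /pushforward /mrestr /= preimage_setI setIA.
  have -> : m2 B = ((A i c)%:E * mu (B `&` starts i))%E by [].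
  (* Intersecting with [starts i] leaves nothing or a cylinder of positive length, the only kind
     covered by the formula for [mu]. *)
  have [->|[n [b [b0 ->]]]] : B `&` starts i = set0 \/
      exists n b, b 0%N = i /\ B `&` starts i = agree n.+1 b.
  + case: cB => [->|[[|m] [a ->]]]; first by rewrite set0I; left.
      right; exists 0%N, (fun=> i); split=> //; apply/seteqP.
      split=> [x [_ xi] [|//] _|x xi]; first by rewrite -xi.
      by split=> //; rewrite /starts /= -xi.
    have [ai|ai] := eqVneq (a 0%N) i; last first.
      left; rewrite -subset0 => x [ax xi]; move/eqP : ai; apply.
      by rewrite (ax 0%N) // -xi.
    right; exists m, a; split=> //; apply/seteqP; split=> [x []//|x ax].
    by split=> //; rewrite /starts /= -ax.
  + by rewrite preimage_set0 set0I measure0 mule0.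
  have agreeE k (x : left_sequences N) : agree k.+1 x =
      [set y | forall j, (j <= k)%N -> y j = x j].
    by apply/seteqP; split=> y xy j jk; rewrite xy.
  have -> : @left_shift N @^-1` agree n.+1 b `&` starts c = agree n.+2 (extend c b).
    apply/seteqP; split=> [x [bx xc] [|j] jn|x bx]; first by rewrite -xc.
      exact: bx.
    by split=> [j jn|]; [exact: (bx j.+1)|rewrite /starts /= -bx].
  rewrite !agreeE !hmu -EFinM; congr EFin.
  by rewrite big_ord_recl /= b0 mulrCA.
- move=> _; change (m1 setT < +oo)%E.
  rewrite /m1 /pushforward /mrestr /= preimage_setT setTI.
  exact: le_lt_trans (probability_le1 mu mci) (ltry _).
Qed.

(** * The transfer operator of the shift *)

(** The dual of composition with the shift: the conditional expectation of [f] given that the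
    shifted point is [x]. *)
Definition transfer (R : realType) (N : nat) (A : 'M[R]_N.+1)
    (f : lseq N -> R) (x : lseq N) : R :=
  \sum_c A ((x : left_sequences N) 0%N) c * f (extend c x).

Lemma ge0_integral_fibers (R : realType) d (T : measurableType d)
    (mu : {measure set T -> \bar R}) (I : finType) (xi : T -> I)
    (f : T -> \bar R) :
  (forall i, measurable (xi @^-1` [set i])) -> measurable_fun setT f ->
  (forall x, 0 <= f x)%E ->
  (\int[mu]_x f x = \sum_i \int[mu]_(x in xi @^-1` [set i]) f x)%E.
Proof.
move=> mxi mf f0.
have E : \big[setU/set0]_i (xi @^-1` [set i]) = setT.
  apply/seteqP; split=> // x _; rewrite -bigcup_seq.
  by exists (xi x) => //=; rewrite mem_index_enum.
rewrite -E ge0_integral_bigsetU //=; last 3 first.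
- exact: index_enum_uniq.
- apply/trivIsetP => i j _ _ /eqP ij; rewrite -subset0 => x [xi_i xi_j].
  by apply: ij; rewrite -xi_i -xi_j.
- by rewrite E.
Qed.

Section transfer_operator.
Context (R : realType) (N : nat) (A : 'M[R]_N.+1) (mu : probability (lseq N) R).
Hypotheses (A0 : forall i j, 0 <= A i j) (hmu : markov_measure A mu).

Lemma transfer_ge0 f x : (forall y, 0 <= f y) -> 0 <= transfer A f x.
Proof. by move=> f0; apply: sumr_ge0 => c _; apply: mulr_ge0. Qed.

Lemma measurable_row c :
  measurable_fun [set: lseq N] (fun x => A ((x : left_sequences N) 0%N) c).
Proof.
move=> _ B mB; rewrite setTI.
by apply: (@measurable_agree_closed _ 1) => x y xy; rewrite /= (xy 0%N).
Qed.

Lemma measurable_transfer f : measurable_fun setT f ->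
  measurable_fun setT (transfer A f).
Proof.
move=> mf; apply: measurable_sum => c; apply: measurable_funM.
  exact: measurable_row.
exact: measurableT_comp (measurable_extend c).
Qed.

(** A change of variables along [extend c]: by [markov_shift], on this cylinder [mu] is the image of
    [A i c] times [mu] restricted to [starts i]. *)
Lemma integral_branch c i (f : lseq N -> \bar R) :
  measurable_fun setT f -> (forall x, 0 <= f x)%E ->
  (\int[mu]_(x in @left_shift N @^-1` starts i `&` starts c) f x =
   (A i c)%:E * \int[mu]_(x in starts i) f (extend c x))%E.
Proof.
move=> mf f0.
have mS : measurable (@left_shift N @^-1` starts i `&` starts c : set (lseq N)).
  apply: measurableI (measurable_starts c).
  rewrite -[X in measurable X]setTI.
  exact: measurable_left_shift (measurable_starts i).
pose m := mscale (NngNum (A0 i c)) mu.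
have mext := @measurable_extend N c.
have mfe : measurable_fun (starts i) (f \o extend c).
  by apply: measurable_funTS; exact: measurableT_comp.
transitivity (\int[pushforward m (extend c : lseq N -> lseq N)]_(x in
    @left_shift N @^-1` starts i `&` starts c) f x)%E.
  apply: eq_measure_integral => B mB BS; rewrite /pushforward.
  have mB' : measurable (extend c @^-1` B : set (lseq N)).
    by rewrite -[X in measurable X]setTI; exact: mext.
  have := @markov_shift R N A mu A0 hmu c i _ mB'.
  have -> : extend c @^-1` B `&` starts i = extend c @^-1` B.
    by apply: setIidl => x /BS [].
  move=> e; rewrite -[RHS]/((A i c)%:E * mu (extend c @^-1` B))%E -e.
  congr (mu _); apply/seteqP; split=> x.
    by move=> Bx; have [_ <-] := BS x Bx; rewrite /= extend_left_shift.
  by move=> [Bx xc]; move: Bx; rewrite -xc /= extend_left_shift.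
rewrite (ge0_integral_pushforward mext) //; last by apply: measurable_funTS.
have -> : extend c @^-1` (@left_shift N @^-1` starts i `&` starts c) = starts i.
  by apply/seteqP; split=> [x []|x]//; split.
have mi := measurable_starts i.
by rewrite ge0_integral_mscale // => x _; exact: f0.
Qed.

(** Split the left side by the newest symbol and the right side by the two newest symbols; the
    pieces correspond by [integral_branch]. *)
Lemma integral_transfer (f : lseq N -> R) :
  measurable_fun setT f -> (forall x, 0 <= f x) ->
  (\int[mu]_x (transfer A f x)%:E = \int[mu]_x (f x)%:E)%E.
Proof.
move=> mf f0.
have mEf : measurable_fun setT (EFin \o f) by exact/measurable_EFinP.
rewrite (@ge0_integral_fibers R _ (lseq N) mu _
  (fun x : lseq N => (x : left_sequences N) 0%N)); first last.
- by move=> x; rewrite lee_fin transfer_ge0.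
- by apply/measurable_EFinP; exact: measurable_transfer.
- by move=> i; exact: measurable_starts.
rewrite [RHS](@ge0_integral_fibers R _ (lseq N) mu _
  (fun x : lseq N => ((x : left_sequences N) 1%N, (x : left_sequences N) 0%N))); first last.
- by move=> x; rewrite lee_fin.
- by [].
- move=> u; apply: (@measurable_agree_closed _ 2) => x y xy /=.
  by rewrite !xy.
rewrite [RHS](_ : _ = \sum_i \sum_c \int[mu]_(x in
    @left_shift N @^-1` starts i `&` starts c) (f x)%:E)%E; last first.
  rewrite pair_bigA /=; apply: eq_bigr => -[i c] _ /=.
  by congr (integral _ _ _); apply/seteqP; split=> x; [case=> <- <-|case=> /= <- <-].
apply: eq_bigr => i _.
transitivity (\int[mu]_(x in starts i) \sum_c ((A i c)%:E * (f (extend c x))%:E))%E.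
  apply: eq_integral => x; rewrite inE => xi.
  by rewrite /transfer -sumEFin; apply: eq_bigr => c _; rewrite EFinM -xi.
have mfe c : measurable_fun (starts i) (fun x => (f (extend c x))%:E).
  apply: measurable_funTS.
  by apply: (measurableT_comp mEf); exact: measurable_extend.
rewrite ge0_integral_sum; last 3 first.
- exact: measurable_starts.
- by move=> c; apply: measurable_funeM.
- by move=> c x _; rewrite mule_ge0 // lee_fin.
apply: eq_bigr => c _; rewrite ge0_integralZl_EFin //; last 2 first.
- exact: measurable_starts.
- by move=> x _; rewrite lee_fin.
by rewrite -(@integral_branch c i (EFin \o f)) // => x; rewrite lee_fin.
Qed.

End transfer_operator.

(** * The conditional probabilities of preimages are the entries of [A] *)

Section disintegrations.
Context (R : realType) (N : nat) (A : 'M[R]_N.+1) (mu : probability (lseq N) R).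
Hypotheses (A0 : forall i j, 0 <= A i j) (hmu : markov_measure A mu).
Variable k : R.-pker (lseq N) ~> (lseq N).
Hypothesis hk : disintegration mu (@left_shift N) k.

(** Both sides have the same integral over every measurable [E]: cutting [F] down to the preimage of
    [E] under the shift restricts its transfer to [E]. *)
Lemma disintegration_transfer (F : set (lseq N)) : measurable F ->
  {ae mu, forall x, k x F = (transfer A \1_F x)%:E}.
Proof.
move=> mF.
have mkF : measurable_fun setT (fun x => k x F) by exact: measurable_kernel.
have mtF : measurable_fun setT (transfer A (\1_F : lseq N -> R)).
  by apply: measurable_transfer; apply: measurable_indic.
suff : ae_eq mu setT (fun x => k x F) (fun x => (transfer A \1_F x)%:E).
  by apply: filterS => x /(_ Logic.I).
apply: integral_ae_eq => //.
- apply/integrableP; split=> //.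
  under eq_integral do rewrite gee0_abs //.
  rewrite -hk //.
  apply: (le_lt_trans (probability_le1 mu _)); last exact: ltry.
  by rewrite preimage_setT setIT.
- exact/measurable_EFinP.
move=> E _ mE; rewrite -hk //.
have mTE : measurable (@left_shift N @^-1` E : set (lseq N)).
  by rewrite -[X in measurable X]setTI; exact: measurable_left_shift.
have mFE : measurable (F `&` @left_shift N @^-1` E : set (lseq N)).
  exact: measurableI.
transitivity (\int[mu]_x (transfer A \1_(F `&` @left_shift N @^-1` E) x)%:E)%E.
  rewrite integral_transfer //.
  by rewrite integral_indic // setIT.
rewrite [RHS]integral_mkcond; apply: eq_integral => x _.
rewrite patchE; have [xE|xE] := boolP (x \in E); congr EFin.
  apply: eq_bigr => c _; congr (_ * _).
  rewrite !indicE; congr (_%:R); congr nat_of_bool.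
  by rewrite in_setI (_ : (_ \in @left_shift N @^-1` E) = true) ?andbT.
apply: big1 => c _; rewrite indicE memNset ?mulr0 //.
by move=> [_] /=; rewrite left_shift_extend; move/mem_set; apply/negP.
Qed.

(** Countably many cylinders allow a single null set for all of them; a point is then reached as a
    decreasing intersection of cylinders. *)
Lemma disintegration_row :
  {ae mu, forall x : lseq N, forall c,
     k x [set extend c x] = (A ((x : left_sequences N) 0%N) c)%:E}.
Proof.
(* Decoding [n] with default [[::]] runs through all finite words. *)
have h : {ae mu, forall x, forall n : nat,
    k x (prefix_cylinder (odflt [::] (unpickle n))) =
    (transfer A \1_(prefix_cylinder (odflt [::] (unpickle n))) x)%:E}.
  apply/ae_foralln => n; apply: disintegration_transfer.
  exact: measurable_agree.
apply: filterS h => x h c.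
have {}h m (y : left_sequences N) :
    k x (agree m y) = (transfer A \1_(agree m y) x)%:E.
  by have := h (pickle (mkseq y m)); rewrite pickleK /= agree_prefix_cylinder.
(* With length at least 1 the cylinder contains no extension of [x] other than [extend c x]. *)
have step m : k x (agree m.+1 (extend c x)) = (A ((x : left_sequences N) 0%N) c)%:E.
  rewrite h /transfer (bigD1 c) //= big1 ?addr0 => [|d dc]; rewrite indicE.
    by rewrite mem_set // mulr1.
  by rewrite memNset ?mulr0 // => /(_ 0%N isT) /= /esym/eqP; exact/negP.
have -> : [set extend c x] = \bigcap_m agree m.+1 (extend c x).
  apply/seteqP; split=> [_ -> //|y xy]; apply/funext => i.
  by rewrite -(xy i).
have : k x \o (fun m => agree m.+1 (extend c x)) @ \oo -->
    k x (\bigcap_m agree m.+1 (extend c x)).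
  apply: nonincreasing_cvg_mu.
  - by rewrite step ltry.
  - by move=> m; exact: measurable_agree.
  - by apply: bigcapT_measurable => m; exact: measurable_agree.
  - move=> m n mn; apply/subsetPset => y; exact: agree_leq.
rewrite (_ : k x \o _ = cst (A ((x : left_sequences N) 0%N) c)%:E); last first.
  by apply/funext => m; exact: step.
by move=> /cvg_lim <- //; rewrite lim_cst.
Qed.

End disintegrations.

(** * Branches, their coupling, and tree partitions *)

(* Points whose preimages under the shift, labelled by [br], list the nonzero
   entries of the row of [A] at the first coordinate. *)
Definition row_branching (R : realType) (s N : nat) (p : 'I_s -> R)
    (A : 'M[R]_N.+1) (br : 'I_s -> left_sequences N -> left_sequences N)
    (x : left_sequences N) : Prop :=
  [/\ forall a, br a x = extend (br a x 0%N) x,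
      forall a, A (x 0%N) (br a x 0%N) = p a,
      injective (fun a => br a x 0%N)
    & forall c, A (x 0%N) c != 0 -> exists a, br a x 0%N = c].

(** The labels [a] enumerate exactly the columns with nonzero entry, and the other columns
    contribute nothing. *)
Lemma transfer_branching (R : realType) (s N : nat) (p : 'I_s -> R)
    (A : 'M[R]_N.+1) br (f : lseq N -> R) x :
  (forall a, 0 < p a) -> row_branching p A br x ->
  transfer A f x = \sum_a p a * f (br a x).
Proof.
move=> p0 [brE brA brI brS].
rewrite /transfer (bigID (fun c => A ((x : left_sequences N) 0%N) c != 0)) /=.
rewrite [X in _ + X]big1 ?addr0; last by move=> c /negPn/eqP ->; rewrite mul0r.
rewrite (eq_bigl (mem [set br a x 0%N | a in [set: 'I_s]]%SET)); last first.
  move=> c; apply/idP/imsetP => [/brS[a <-]|[a _ ->]]; first by exists a.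
  by rewrite brA gt_eqF.
rewrite big_imset /=; last by move=> a b _ _; exact: brI.
rewrite (eq_bigl xpredT) => [|a]; last by rewrite finset.in_setT.
by apply: eq_bigr => a _; rewrite brA [in RHS]brE.
Qed.

(** This supplies the hypothesis of [coupling_automorphism]. If the symbols agree, both families of
    children list the same row of [A] and are matched by symbol; weights then agree, being entries
    of [A]. *)
Lemma branching_coupling (R : realType) (s N : nat) (p : 'I_s -> R)
    (A : 'M[R]_N.+1) br (x y : left_sequences N) :
  (forall a, 0 < p a) ->
  (forall i j, exists k, A i k = A j k /\ A i k != 0) ->
  row_branching p A br x -> row_branching p A br y ->
  exists pi : {perm 'I_s}, [/\ forall a, p (pi a) = p a,
     x 0%N = y 0%N -> forall a, br a x 0%N = br (pi a) y 0%N
   & exists a, br a x 0%N = br (pi a) y 0%N].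
Proof.
move=> p0 hcol [brEx brAx brIx brSx] [brEy brAy brIy brSy].
have [k [kxy kx]] := hcol (x 0%N) (y 0%N).
have [a0 a0k] := brSx k kx; have [b0 b0k] : exists b, br b y 0%N = k.
  by apply: brSy; rewrite -kxy.
have [xy|xy] := eqVneq (x 0%N) (y 0%N).
  have /choice[h hP] : forall a, exists b, br b y 0%N = br a x 0%N.
    by move=> a; apply: brSy; rewrite -xy brAx gt_eqF.
  have hI : injective h by move=> a b hab; apply: brIx; rewrite /= -!hP hab.
  exists (perm hI); split=> [a|_ a|]; first by rewrite permE -brAy hP -xy brAx.
    by rewrite permE hP.
  by exists a0; rewrite permE hP.
(* When the symbols differ only one pair of children has to be matched, so a
   transposition of the two labels suffices. *)
exists (tperm a0 b0); split=> [a||]; last by exists a0; rewrite tpermL a0k b0k.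
  have pab : p a0 = p b0 by rewrite -brAx -brAy a0k b0k.
  by case: tpermP => // ->.
by move=> e; rewrite e eqxx in xy.
Qed.

(** Tree names involve all iterated preimages of a point, so an almost sure property is wanted at
    every node at once. Points with an allowed extension in a null set form a null set; all iterates
    of this operation [pre] on the bad set are removed. *)
Lemma conull_branch_closed (R : realType) (N : nat) (A : 'M[R]_N.+1)
    (mu : probability (lseq N) R) (Z : lseq N -> Prop) :
  (forall i j, 0 <= A i j) -> markov_measure A mu -> {ae mu, forall x, Z x} ->
  exists G : set (lseq N), [/\ measurable G, mu (~` G) = 0%E, G `<=` Z
    & forall x c, A ((x : left_sequences N) 0%N) c != 0 -> G x -> G (extend c x)].
Proof.
move=> A0 hmu [B [mB B0 ZB]].
pose pre (B : set (lseq N)) : set (lseq N) := \bigcup_(c in [set: 'I_N.+1])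
  \bigcup_(i in [set i | A i c != 0]) (extend c @^-1` B `&` starts i).
have mpre_aux c i (C : set (lseq N)) : measurable C ->
    measurable (extend c @^-1` C `&` starts i : set (lseq N)).
  move=> mC; apply: measurableI; last exact: measurable_starts.
  by rewrite -[X in measurable X]setTI; exact: measurable_extend.
have mpre C : measurable C -> measurable (pre C).
  move=> mC; apply: fin_bigcup_measurable => // c _.
  by apply: fin_bigcup_measurable => // i _; exact: mpre_aux.
have pre0 C : measurable C -> mu C = 0%E -> mu (pre C) = 0%E.
  move=> mC C0; apply/negligibleP; first exact: mpre.
  have : {ae mu, forall x, forall u : 'I_N.+1 * 'I_N.+1,
      ~ (A u.2 u.1 != 0 /\ (extend u.1 @^-1` C `&` starts u.2) x)}.
    apply: filter_forall => -[c i] /=.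
    have [Aic|Aic] := eqVneq (A i c) 0; first by apply: nearW => x [].
    have mS := mpre_aux c i C mC.
    exists (extend c @^-1` C `&` starts i : set (lseq N)); split=> //.
      (* By [markov_shift] this product is the measure of a subset of [C]. *)
      have : ((A i c)%:E * mu (extend c @^-1` C `&` starts i) = 0)%E.
        rewrite -markov_shift //; last first.
          by rewrite -[X in measurable X]setTI; exact: measurable_extend.
        apply: (@subset_measure0 _ _ _ mu _ C) => //.
          apply: measurableI; last exact: measurable_starts.
          by rewrite -[X in measurable X]setTI; exact: measurable_left_shift.
        by move=> x [[/= Cx _] xc]; move: Cx; rewrite -xc extend_left_shift.
      by move=> /eqP; rewrite mule_eq0 eqe (negbTE Aic) => /eqP.
    by move=> x /contrapT [].
  apply: negligibleS => x [c _ [i Aic Sx]] /(_ (c, i)); exact.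
have miter l : measurable (iter l pre B) by elim: l => //= l; exact: mpre.
have iter0 l : mu (iter l pre B) = 0%E.
  by elim: l => //= l; apply: pre0; exact: miter.
have mU : measurable (\bigcup_l iter l pre B) by exact: bigcupT_measurable.
exists (~` \bigcup_l iter l pre B); split.
- exact: measurableC.
- rewrite setCK; apply/(negligibleP _ mU); apply: negligible_bigcup => l.
  by apply/(negligibleP _ (miter l)); exact: iter0.
- move=> x Gx; apply: contrapT => nZ; apply: Gx; exists 0%N => //.
  exact: ZB.
- move=> x c Axc Gx [l _ lx]; apply: Gx; exists l.+1 => //=.
  by exists c => //; exists ((x : left_sequences N) 0%N).
Qed.

Lemma preimages_row (R : realType) (N : nat) (A : 'M[R]_N.+1)
    (k : R.-pker (lseq N) ~> (lseq N)) (x y : left_sequences N) :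
  (forall i j, 0 <= A i j) ->
  (forall c, k x [set extend c x] = (A (x 0%N) c)%:E) ->
  preimages (@left_shift N) k x y <-> y = extend (y 0%N) x /\ A (x 0%N) (y 0%N) != 0.
Proof.
move=> A0 kx; split=> [[Ty]|[yE Axy]].
  rewrite -{1}(extend_left_shift y) Ty kx lte_fin => Axy; split.
    by rewrite -{1}(extend_left_shift y) Ty.
  by rewrite gt_eqF.
by split; rewrite yE // kx lte_fin lt_neqAle eq_sym Axy A0.
Qed.

Lemma branch_row_branching (R : realType) (s N : nat) (p : 'I_s -> R)
    (A : 'M[R]_N.+1) (k : R.-pker (lseq N) ~> (lseq N)) (K : lseq N -> 'I_s)
    (x : left_sequences N) :
  (forall i j, 0 <= A i j) ->
  (forall c, k x [set extend c x] = (A (x 0%N) c)%:E) ->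
  set_bij (preimages (@left_shift N) k x) [set: 'I_s] K ->
  (forall y, preimages (@left_shift N) k x y -> k x [set y] = (p (K y))%:E) ->
  row_branching p A (branch (@left_shift N) k K) x.
Proof.
move=> A0 kx [_ Kinj Ksurj] kp.
(* The dummy value of [branch] is not taken here, since [K] maps the preimages of [x] onto all
   labels. *)
have brP a : preimages (@left_shift N) k x (branch (@left_shift N) k K a x) /\
    K (branch (@left_shift N) k K a x) = a.
  have [y Py Ky] := Ksurj a Logic.I.
  apply: (@xgetPex _ x [set y | preimages (@left_shift N) k x y /\ K y = a]).
  by exists y.
have brE a : branch (@left_shift N) k K a x =
    extend (branch (@left_shift N) k K a x 0%N) x.
  by have [/(preimages_row _ A0 kx)[]] := brP a.
split=> // [a|a b /= e|c Axc].
- have [Pa Ka] := brP a; have := kp _ Pa.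
  by rewrite Ka {1}brE kx => -[].
- by rewrite -(brP a).2 -(brP b).2 brE e -brE.
- have Pc : preimages (@left_shift N) k x (extend c x).
    by apply/(preimages_row _ A0 kx).
  exists (K (extend c x)).
  have [Pb Kb] := brP (K (extend c x)).
  by rewrite (Kinj _ _ _ _ Kb) ?inE.
Qed.

Lemma conull_row_branching (R : realType) (s N : nat) (p : 'I_s -> R)
    (A : 'M[R]_N.+1) (mu : probability (lseq N) R)
    (k : R.-pker (lseq N) ~> (lseq N)) (K : lseq N -> 'I_s) :
  (forall a, 0 < p a) -> (forall i j, 0 <= A i j) -> markov_measure A mu ->
  tree_partition p mu (@left_shift N) k K ->
  exists G : set (lseq N), [/\ measurable G, mu (~` G) = 0%E,
    forall x, G x -> row_branching p A (branch (@left_shift N) k K) x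
  & forall x a, G x -> G (branch (@left_shift N) k K a x)].
Proof.
move=> p0 A0 hmu [hk _ hK].
have [G [mG G0 GZ Gext]] :=
  conull_branch_closed A0 hmu (filterI (disintegration_row A0 hmu hk) hK).
have Grow x : G x -> row_branching p A (branch (@left_shift N) k K) x.
  by move=> /GZ[kx [Kb Kp]]; exact: branch_row_branching.
exists G; split=> // x a Gx; have [brE brA _ _] := Grow x Gx.
by rewrite brE; apply: Gext => //; rewrite brA gt_eqF.
Qed.

(** For each symbol [i], a labelling [e i] of the nonzero entries of row [i] is read off at one
    typical point of [starts i], which has positive measure. The partition labels a point by its
    newest transition. *)
Lemma tree_partition_exists (R : realType) (s N : nat) (p : 'I_s -> R)
    (A : 'M[R]_N.+1) (mu : probability (lseq N) R) :
  prob_vector p -> (forall i j, 0 <= A i j) -> markov_measure A mu ->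
  p_endomorphism p mu (@left_shift N) ->
  exists k K, tree_partition p mu (@left_shift N) k K.
Proof.
move=> [p0 p1] A0 hmu [_ [k hk hpre] _].
have hrow := disintegration_row A0 hmu hk.
have /choice[e eP] : forall i, exists e : 'I_s -> 'I_N.+1,
    [/\ injective e, forall j, A i (e j) = p j
      & forall c, A i c != 0 -> exists j, e j = c].
  move=> i; have [q [q0 _ _] hq] := hmu.
  have mui : mu (starts i) = (q 0 i)%:E.
    have := hq 0%N (fun=> i); rewrite big_ord0 mulr1 => <-; congr (mu _).
    apply/seteqP; split=> x xi; last exact: (xi 0%N).
    by move=> j; rewrite leqn0 => /eqP ->.
  have [x [xi [kx [y [yinj yP yp]]]]] : exists x : left_sequences N,
      x 0%N = i /\ (forall c, k x [set extend c x] = (A (x 0%N) c)%:E) /\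
      exists y : 'I_s -> left_sequences N, [/\ injective y,
        preimages (@left_shift N) k x = range y
        & forall j, k x [set y j] = (p j)%:E].
    apply: contrapT => none; have [B [mB B0 hB]] := filterI hrow hpre.
    have : mu (starts i) = 0%E.
      apply: (@subset_measure0 _ _ _ mu _ B) => //; first exact: measurable_starts.
      by move=> x xi; apply: hB => -[kx hx]; apply: none; exists x.
    by rewrite mui => -[/eqP]; rewrite gt_eqF.
  have yE j : y j = extend (y j 0%N) x.
    by have [] := (preimages_row (y j) A0 kx).1; rewrite ?yP; first exists j.
  exists (fun j => y j 0%N); split=> [j j' /= e|j|c Aic].
  - by apply: yinj; rewrite yE e -yE.
  - by have := yp j; rewrite {1}yE kx xi => -[].
  - have : preimages (@left_shift N) k x (extend c x).
      by apply/(preimages_row _ A0 kx); rewrite xi.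
    by rewrite yP => -[j _ yj]; exists j; rewrite yj.
have [j0 _] : exists j0 : 'I_s, True.
  have [j _|noj] := pickP (@predT 'I_s); first by exists j.
  by move: p1; rewrite big_pred0 // => /eqP; rewrite eq_sym oner_eq0.
(* The transition goes from [y 1] to [y 0]; the default [j0] occurs only at forbidden
   transitions. *)
pose K (y : left_sequences N) : 'I_s :=
  odflt j0 [pick j | e (y 1%N) j == y 0%N].
exists k, K; split=> //.
  move=> j; apply: (@measurable_agree_closed _ 2) => x y xy /=.
  by rewrite /K !xy.
apply: filterS hrow => x kx.
have Kext j : K (extend (e (x 0%N) j) x) = j.
  rewrite /K /=; case: pickP => [j' /eqP ej|/(_ j)]; last by rewrite eqxx.
  by have [einj _ _] := eP (x 0%N); exact: einj.
have Kpre y : preimages (@left_shift N) k x y -> y = extend (e (x 0%N) (K y)) x.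
  move=> /(preimages_row _ A0 kx)[yE]; have [_ _ esurj] := eP (x 0%N).
  by move=> /esurj[j ej]; rewrite yE -ej Kext.
split.
  split=> [//|y y' /set_mem Py /set_mem Py' KK|j _].
    by rewrite (Kpre y Py) (Kpre y' Py') KK.
  exists (extend (e (x 0%N) j) x) => //.
  apply/(preimages_row _ A0 kx); split=> //=.
  by have [_ -> _] := eP (x 0%N); rewrite gt_eqF.
move=> y Py; rewrite {1}(Kpre y Py) kx.
by have [_ -> _] := eP (x 0%N).
Qed.

(** * Finite covers and diameter of a compact metric space *)

Lemma compact_finite_cover (R : realType) (M : metricType R) (x0 : M)
    (I : choiceType) (f : I -> set M) :
  compact [set: M] -> (forall i, open (f i)) -> (forall z, exists i, f i z) ->
  exists s : seq I, forall z, exists2 i, i \in s & f i z.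
Proof.
pose PM : ptopologicalType :=
  HB.pack (Metric.sort M) (isPointed.Build (Metric.sort M) x0).
move=> cM fo fc.
have cPM : @compact PM setT by exact: cM.
rewrite compact_cover in cPM.
have [||D _ Dc] := cPM I setT f; first by move=> i _; exact: fo.
  by move=> z _; have [i fiz] := fc z; exists i.
exists (finmap.enum_fset D) => z; have [i /= iD fiz] := Dc z Logic.I.
by exists i.
Qed.

Lemma compact_diameter (R : realType) (M : metricType R) :
  compact [set: M] -> exists2 D : R, 0 < D & forall z z' : M, mdist z z' <= D.
Proof.
move=> cM; have [[x0 _]|noM] := pselect (exists x0 : M, True); last first.
  by exists 1 => // z; exfalso; apply: noM; exists z.
have [||s sP] := @compact_finite_cover R M x0 nat
  (fun n => (ball x0 n.+1%:R)°) cM.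
- by move=> n; exact: open_interior.
- move=> z; exists (Num.truncn (mdist x0 z)).
  rewrite /interior -metricType_numDomainType.filter_from_mdist_nbhs.
  exists ((Num.truncn (mdist x0 z)).+1%:R - mdist x0 z) => /=.
    by rewrite subr_gt0 truncnS_gt.
  move=> y /= zy; rewrite ballEmdist /=.
  by apply: le_lt_trans (metric_triangle x0 z y) _; rewrite -ltrBrDl.
(* The sum of the radii is a convenient bound for the largest one. *)
pose D : R := (\sum_(n <- s) n.+1%:R); have D0 : 0 <= D by exact: sumr_ge0.
have xD z : mdist x0 z <= D.
  have [n ns /interior_subset] := sP z; rewrite ballEmdist /= => /ltW /le_trans.
  by apply; rewrite /D (big_rem n ns) /= lerDl sumr_ge0.
(* Adding 1 makes the bound positive, so that it can serve as a divisor. *)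
exists (1 + (D + D)); first by rewrite ltr_pwDl // addr_ge0.
move=> z z'; apply: le_trans (metric_triangle z x0 z') _.
by rewrite (metric_sym z) (le_trans (lerD (xD z) (xD z'))) // lerDr.
Qed.

Lemma compact_small_cover (R : realType) (M : metricType R) (e : R) :
  compact [set: M] -> 0 < e ->
  exists s : seq (set M), [/\ forall U, U \in s -> open U,
    forall U z z', U \in s -> U z -> U z' -> mdist z z' < e
  & forall z, exists2 U, U \in s & U z].
Proof.
move=> cM e0; have [[x0 _]|noM] := pselect (exists x0 : M, True); last first.
  by exists [::]; split=> // z; exfalso; apply: noM; exists z.
have e2 : 0 < e / 2 by rewrite divr_gt0.
have [||s sP] := @compact_finite_cover R M x0 M (fun c => (ball c (e / 2))°) cM.
- by move=> c; exact: open_interior.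
- by move=> z; exists z; exact: nbhsx_ballx.
exists [seq (ball c (e / 2))° | c <- s]; split.
- by move=> U /mapP[c _ ->]; exact: open_interior.
- move=> U z z' /mapP[c _ ->] /interior_subset + /interior_subset.
  rewrite ballEmdist /= => cz cz'; apply: le_lt_trans (metric_triangle z c z') _.
  by rewrite (metric_sym z) [ltRHS](splitr e) ltrD.
- by move=> z; have [c cs cz] := sP z; exists ((ball c (e / 2))°) => //; exact: map_f.
Qed.

(** * Approximation of measurable maps by finitely many coordinates *)

(** This amounts to approximability of [B] in measure by sets depending on finitely many
    coordinates; the explicit exceptional set lets the property pass to maps. *)
Definition almost_local (R : realType) (N : nat) (mu : probability (lseq N) R)
    (B : set (lseq N)) : Prop :=
  forall e : R, 0 < e -> exists m (E : set (lseq N)),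
    [/\ measurable E, (mu E <= e%:E)%E
      & forall x y, ~ E x -> ~ E y -> agree m x y -> B x -> B y].

Lemma almost_localC (R : realType) (N : nat) (mu : probability (lseq N) R) B :
  almost_local mu B -> almost_local mu (~` B).
Proof.
move=> hB e e0; have [m [E [mE muE EB]]] := hB e e0; exists m, E; split=> //.
by move=> x y Ex Ey xy nBx By; apply: nBx; apply: EB By => //; exact: agree_sym.
Qed.

Lemma almost_localU (R : realType) (N : nat) (mu : probability (lseq N) R) B C :
  almost_local mu B -> almost_local mu C -> almost_local mu (B `|` C).
Proof.
move=> hB hC e e0; have e2 : 0 < e / 2 by rewrite divr_gt0.
have [m [E [mE muE EB]]] := hB _ e2; have [n [F [mF muF FC]]] := hC _ e2.
exists (maxn m n), (E `|` F); split; first exact: measurableU.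
  apply: le_trans (measureU2 _ mE mF) _.
  by rewrite [e]splitr EFinD leeD.
move=> x y /not_orP[Ex Fx] /not_orP[Ey Fy] xy [Bx|Cx]; [left|right].
  by apply: EB Bx => //; apply: agree_leq xy; exact: leq_maxl.
by apply: FC Cx => //; apply: agree_leq xy; exact: leq_maxr.
Qed.

(** By continuity from above, the union exceeds some [F n] by a set of small measure, which is added
    to the exceptional set of [F n]. *)
Lemma almost_local_bigcup (R : realType) (N : nat) (mu : probability (lseq N) R)
    (F : (set (lseq N))^nat) :
  (forall n, measurable (F n)) -> nondecreasing_seq F ->
  (forall n, almost_local mu (F n)) -> almost_local mu (\bigcup_n F n).
Proof.
move=> mF ndF hF e e0; have e2 : 0 < e / 2 by rewrite divr_gt0.
have mU : measurable (\bigcup_n F n) by exact: bigcupT_measurable.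
have mD n : measurable (\bigcup_n F n `\` F n) by exact: measurableD.
have cap0 : \bigcap_n (\bigcup_n F n `\` F n) = set0.
  rewrite -subset0 => x h; have [[n _ Fn] _] := h 0%N Logic.I.
  by have [_] := h n Logic.I.
have cvg0 : mu \o (fun n => \bigcup_n F n `\` F n) @ \oo --> 0%E.
  rewrite -(measure0 mu) -cap0; apply: nonincreasing_cvg_mu => //.
  - exact: le_lt_trans (probability_le1 mu (mD _)) (ltry _).
  - by rewrite cap0.
  - move=> m n mn; apply/subsetPset => x [Ux nFx]; split=> // Fm.
    by apply: nFx; move/subsetPset : (ndF m n mn); exact.
have [n _ hn] : \forall n \near \oo, (mu (\bigcup_n F n `\` F n) < (e / 2)%:E)%E.
  apply: (cvg0 [set y | (y < (e / 2)%:E)%E]).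
  apply: open_nbhs_nbhs; split; first exact: open_ereal_lt_ereal.
  by rewrite /= lte_fin.
have [m [E [mE muE EF]]] := hF n _ e2.
exists m, (E `|` (\bigcup_n F n `\` F n)); split; first exact: measurableU.
  apply: le_trans (measureU2 _ mE (mD n)) _.
  by rewrite [e]splitr EFinD leeD // ltW // hn /=.
move=> x y /not_orP[Ex Ux] /not_orP[Ey Uy] xy Fx.
exists n => //; apply: EF xy _ => //.
by apply: contrapT => nFx; apply: Ux.
Qed.

(** [U] is the increasing union over [m] of the sets of points whose cylinder of length [m] lies in
    [U]. *)
Lemma almost_local_open (R : realType) (N : nat) (mu : probability (lseq N) R)
    (U : set (left_sequences N)) : open U -> almost_local mu U.
Proof.
move=> oU; pose F m : set (lseq N) := [set x | agree m x `<=` U].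
have FE m x y : agree m x y -> F m x -> F m y.
  by move=> xy Fx z yz; apply: Fx; exact: agree_trans yz.
have -> : U = \bigcup_m F m.
  apply/seteqP; split=> [x Ux|x [m _]]; last exact.
  by have [m mU] := (open_leftP U).1 oU x Ux; exists m.
apply: almost_local_bigcup.
- by move=> m; apply: measurable_agree_closed; exact: FE.
- move=> m n mn; apply/subsetPset => x Fx y xy; apply: Fx.
  exact: agree_leq xy.
- move=> m e e0; exists m, set0; split=> //.
    by rewrite measure0 lee_fin ltW.
  by move=> x y _ _; exact: FE.
Qed.

(** The measurable almost local sets form a sigma-algebra containing the open sets; countable unions
    are reduced to increasing ones through finite unions. *)
Lemma almost_local_measurable (R : realType) (N : nat)
    (mu : probability (lseq N) R) (B : set (lseq N)) :
  measurable B -> almost_local mu B.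
Proof.
suff : <<s (@open (left_sequences N)) >> `<=`
    [set B : set (lseq N) | measurable B /\ almost_local mu B].
  by move=> h /h [].
apply: smallest_sub; last first.
  by move=> U oU; split; [exact: sub_sigma_algebra|exact: almost_local_open].
split.
- split; first exact: measurable0.
  by apply: almost_local_open; exact: open0.
- move=> C [mC hC]; rewrite setTD; split; first exact: measurableC.
  exact: almost_localC.
- move=> F /all_and2[mF hF]; split; first exact: bigcupT_measurable.
  have hn n : measurable (\big[setU/set0]_(i < n) F i : set (lseq N)) /\
      almost_local mu (\big[setU/set0]_(i < n) F i).
    elim: n => [|n [mIH hIH]].
      rewrite big_ord0; split; first exact: measurable0.
      by apply: almost_local_open; exact: open0.
    rewrite big_ord_recr /=; split; first exact: measurableU.
    exact: almost_localU.
  rewrite -bigcup_bigsetU_bigcup; apply: almost_local_bigcup.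
  + by move=> n; have [] := hn n.+1.
  + by move=> m n mn; apply/subsetPset; apply: subset_bigsetU.
  + by move=> n; have [] := hn n.+1.
Qed.

(** Cover [M] by finitely many open sets in which any two points are less than [e] apart, and apply
    almost locality to their preimages. The induction on the cover halves [eta] at each set. *)
Lemma almost_local_function (R : realType) (N : nat) (mu : probability (lseq N) R)
    (M : metricType R) (g : left_sequences N -> M) (e eta : R) :
  compact [set: M] ->
  (forall B : set M, <<s @open M >> B -> measurable (g @^-1` B : set (lseq N))) ->
  0 < e -> 0 < eta -> exists m (E : set (lseq N)),
    [/\ measurable E, (mu E <= eta%:E)%E
      & forall x y, ~ E x -> ~ E y -> agree m x y -> mdist (g x) (g y) < e].
Proof.
move=> cM mg e0 eta0.
have [s [so sd sc]] := compact_small_cover cM e0.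
suff [m [E [mE muE hE]]] : exists m (E : set (lseq N)),
    [/\ measurable E, (mu E <= eta%:E)%E
      & forall U x y, U \in s -> ~ E x -> ~ E y -> agree m x y ->
          U (g x) -> U (g y)].
  exists m, E; split=> // x y Ex Ey xy; have [U Us Ux] := sc (g x).
  by apply: (sd U) => //; exact: hE Ux.
elim: s so {sd sc} eta eta0 => [|U s IH] so eta eta0.
  by exists 0%N, set0; split; rewrite ?measure0 ?lee_fin ?ltW.
have eta2 : 0 < eta / 2 by rewrite divr_gt0.
have [|m [E [mE muE hE]]] := IH _ _ eta2.
  by move=> V Vs; apply: so; rewrite inE Vs orbT.
have hU : almost_local mu (g @^-1` U).
  apply: almost_local_measurable; apply: mg; apply: sub_sigma_algebra.
  by apply: so; rewrite mem_head.
have [n [F [mF muF hF]]] := hU _ eta2.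
exists (maxn m n), (E `|` F); split; first exact: measurableU.
  apply: le_trans (measureU2 _ mE mF) _.
  by rewrite [eta]splitr EFinD leeD.
move=> V x y; rewrite inE => Vs /not_orP[Ex Fx] /not_orP[Ey Fy] xy.
have [->|VU] := eqVneq V U.
  by apply: hF => //; apply: agree_leq xy; exact: leq_maxr.
case/predU1P : Vs => [VU'|Vs]; first by rewrite VU' eqxx in VU.
by apply: hE => //; apply: agree_leq xy; exact: leq_maxl.
Qed.

(** * Estimates for coupled tree names *)

(** Averaging over the newest generation applies [transfer] to [f] once; closure of [G] under the
    branches permits this at every node. *)
Lemma branching_level_sum (R : realType) (s N : nat) (p : 'I_s -> R)
    (A : 'M[R]_N.+1) br (G : set (left_sequences N)) l (f : lseq N -> R) x :
  (forall a, 0 < p a) -> (forall x, G x -> row_branching p A br x) ->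
  (forall x a, G x -> G (br a x)) -> G x ->
  level_sum p l (fun v => f (foldr br x v)) = iter l (transfer A) f x.
Proof.
move=> p0 Grow Gbr Gx; elim: l f => [|l IH] f; first by rewrite level_sum0.
rewrite level_sumS iterSr -IH; apply: eq_level_sum => v _ /=.
rewrite (@transfer_branching R s N p A br f) //; apply: Grow.
by elim: v => //= a v; exact: Gbr.
Qed.

Section coupled_branchings.
Context (R : realType) (s N : nat) (p : 'I_s -> R).
Context (br : 'I_s -> left_sequences N -> left_sequences N).
Context (x y : left_sequences N) (B : seq 'I_s -> seq 'I_s).
Hypothesis brx : forall a v, foldr br x (a :: v) =
  extend (foldr br x (a :: v) 0%N) (foldr br x v).
Hypothesis bry : forall a v, foldr br y (a :: v) =
  extend (foldr br y (a :: v) 0%N) (foldr br y v).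
Hypothesis hB : tree_automorphism p B.
Hypothesis Bmatch : forall v a, foldr br x v 0%N = foldr br y (B v) 0%N ->
  foldr br x (a :: v) 0%N = foldr br y (B (a :: v)) 0%N.

(** All descendants of a matched node are matched, and each generation prepends one common symbol to
    both points. *)
Lemma matched_agree v u : foldr br x u 0%N = foldr br y (B u) 0%N ->
  agree (size v) (foldr br x (v ++ u)) (foldr br y (B (v ++ u))).
Proof.
move=> xyu.
have m w : foldr br x (w ++ u) 0%N = foldr br y (B (w ++ u)) 0%N.
  by elim: w => //= a w IH; exact: Bmatch.
have Bcons a w : exists b, B (a :: w) = b :: B w.
  have [/bij_inj Binj /(_ (a :: w) isT) [/= Bw _]] := hB.
  (* If [B (a :: w)] were empty, [B w] would be empty too, against injectivity. *)
  case Baw : (B (a :: w)) Bw => [|b w'] /= Bw; last by exists b; rewrite Bw.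
  by have /(congr1 size)/eqP := Binj _ _ (etrans Bw (esym Baw)); rewrite ltn_eqF.
elim: v => [//|a v IH].
have := m (a :: v); rewrite cat_cons brx; have [b Bb] := Bcons a (v ++ u).
rewrite Bb bry -Bb /= => ->.
exact: agree_extend.
Qed.

End coupled_branchings.

(** The first [m] terms are at most 1 each, and the remaining ones are dominated by a geometric
    series of sum [delta^-1]. *)
Lemma geometric_delay_sum (R : realType) (delta : R) (b : nat -> R) m n :
  0 < delta -> delta <= 1 -> (forall l, 0 <= b l <= 1) ->
  (forall l, b (m + l)%N <= (1 - delta) ^+ l) ->
  \sum_(1 <= l < n.+1) b l <= m%:R + delta^-1.
Proof.
move=> d0 d1 b01 bm; have b0 l : 0 <= b l by have /andP[] := b01 l.
(* The range is enlarged so that it can be cut at [m] even when [n < m]. *)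
apply: (@le_trans _ _ (\sum_(0 <= l < m + n.+1) b l)).
  rewrite (@big_cat_nat _ _ _ n.+1 0%N) ?leq_addl //=.
  rewrite (@big_cat_nat _ _ _ 1%N 0%N n.+1) //= -addrA addrC -addrA lerDl.
  by rewrite addr_ge0 // sumr_ge0.
rewrite (@big_cat_nat _ _ _ m 0%N) ?leq_addr //= lerD //.
  apply: (@le_trans _ _ (\sum_(0 <= l < m) 1)).
    by apply: ler_sum => l _; have /andP[] := b01 l.
  by rewrite sumr_const_nat subn0.
rewrite -{1}[m]add0n big_addn addKn big_mkord.
apply: (@le_trans _ _ (\sum_(l < n.+1) (1 - delta) ^+ l)).
  by apply: ler_sum => l _; rewrite addnC.
rewrite -(ler_pM2l d0) mulfV ?gt_eqF //.
have := subrX1 (1 - delta) n.+1.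
rewrite addrAC subrr add0r mulNr => /eqP; rewrite -eqr_oppLR opprB => /eqP <-.
by rewrite gerBl exprn_ge0 // subr_ge0.
Qed.

(** The coupling automorphism bounds the infimum. A node costs at most [e] unless one of its two
    points lies in [E] or its ancestor [m] generations up is mismatched or missing; each exception
    costs at most [D]. *)
Lemma tbar_coupling (R : realType) (s N : nat) (p : 'I_s -> R)
    (A : 'M[R]_N.+1) br (G : set (left_sequences N)) (M : metricType R)
    (g : left_sequences N -> M) (D e delta : R) m (E : set (lseq N)) n
    (x y : left_sequences N) :
  prob_vector p -> (forall i j, exists k, A i k = A j k /\ A i k != 0) ->
  (forall x, G x -> row_branching p A br x) ->
  (forall x a, G x -> G (br a x)) ->
  (forall z z' : M, mdist z z' <= D) -> 0 < e ->
  (forall u w, ~ E u -> ~ E w -> agree m u w -> mdist (g u) (g w) < e) ->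
  0 < delta -> delta <= 1 -> (forall a, delta <= p a) ->
  G x -> G y -> (0 < n)%N ->
  tbar p n (fun v => g (foldr br x v)) (fun v => g (foldr br y v)) <=
  e + n%:R^-1 * (D * (\sum_(1 <= l < n.+1) iter l (transfer A) \1_E x +
    \sum_(1 <= l < n.+1) iter l (transfer A) \1_E y + (m%:R + delta^-1))).
Proof.
move=> [p0 p1] hcol Grow Gbr gD e0 hE d0 d1 dp Gx Gy n0.
have p0' a : 0 <= p a by exact: ltW.
have D0 : 0 <= D by exact: le_trans (mdist_ge0 (g x) (g x)) (gD _ _).
have Gfold z v : G z -> G (foldr br z v).
  by move=> Gz; elim: v => //= a v; exact: Gbr.
have [|B [hB [Binj Bsize Bw] Bmatch Bex]] := @coupling_automorphism R s p _
    (fun v => foldr br x v 0%N) (fun v => foldr br y v 0%N).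
  move=> v w; apply: (branching_coupling p0 hcol); exact/Grow/Gfold.
pose mis v := (foldr br x v 0%N != foldr br y (B v) 0%N).
(* Nodes of level below [m] have no ancestor [m] generations up and count as exceptional. *)
pose far v : R := if (m <= size v)%N then (mis (drop m v))%:R else 1.
have brE z a v : G z -> foldr br z (a :: v) =
    extend (foldr br z (a :: v) 0%N) (foldr br z v).
  by move=> Gz; have [brE _ _ _] := Grow _ (Gfold z v Gz); exact: brE.
have far01 v : 0 <= far v <= 1.
  rewrite /far; case: ifP => _; rewrite ?ler01 ?lexx //.
  by case: (mis _); rewrite ?ler01 ?lexx.
have dist v : mdist (g (foldr br x v)) (g (foldr br y (B v))) <=
    e + D * (\1_E (foldr br x v) + \1_E (foldr br y (B v)) + far v).
  have [Ex|Ex] := pselect (E (foldr br x v)).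
    rewrite indicE mem_set //; apply: (le_trans (gD _ _)).
    apply: ler_wpDl; first exact: ltW.
    apply: ler_peMr => //.
    by rewrite -addrA lerDl addr_ge0 // ?indicE //; have /andP[] := far01 v.
  have [Ey|Ey] := pselect (E (foldr br y (B v))).
    rewrite [\1_E (foldr br y (B v))]indicE (mem_set Ey).
    apply: (le_trans (gD _ _)); apply: ler_wpDl; first exact: ltW.
    apply: ler_peMr => //.
    rewrite addrAC lerDr addr_ge0 // ?indicE //; have /andP[] := far01 v; done.
  rewrite !indicE !memNset // !add0r.
  have [far1|nfar1] := eqVneq (far v) 1.
    by rewrite far1 mulr1 (le_trans (gD _ _)) // lerDr ltW.
  apply: (@le_trans _ _ e); last first.
    by rewrite lerDl mulr_ge0 //; have /andP[] := far01 v.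
  apply/ltW/hE => //; move: nfar1; rewrite /far.
  case: ifP => [mv|_]; last by rewrite eqxx.
  rewrite /mis; case: (eqVneq (foldr br x (drop m v) 0%N)) => [xy _|_]; last first.
    by rewrite eqxx.
  have := @matched_agree _ _ _ _ br x y B (fun a v => brE x a v Gx)
    (fun a v => brE y a v Gy) hB Bmatch (take m v) (drop m v) xy.
  by rewrite cat_take_drop size_take_min (minn_idPl mv).
rewrite /tbar.
set S := (X in inf X).
have Slb : has_lbound S.
  exists 0 => _ [C _ <-]; apply: sumr_ge0 => l _; apply: sumr_ge0 => v _.
  by rewrite mulr_ge0 ?weight_ge0 ?mdist_ge0.
have nI : 0 <= n%:R^-1 :> R by rewrite invr_ge0.
apply: le_trans (ler_wpM2l nI (ge_inf Slb _)) _; first by exists B.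
rewrite [leRHS](_ : _ = n%:R^-1 * (\sum_(1 <= l < n.+1) e +
    D * (\sum_(1 <= l < n.+1) iter l (transfer A) \1_E x +
    \sum_(1 <= l < n.+1) iter l (transfer A) \1_E y + (m%:R + delta^-1)))); last first.
  rewrite [in RHS]mulrDr; congr (_ + _).
  by rewrite sumr_const_nat subn1 /= -[e *+ n]mulr_natl mulKf // pnatr_eq0 -lt0n.
apply: ler_wpM2l => //.
have far_sum : \sum_(1 <= l < n.+1) level_sum p l far <= m%:R + delta^-1.
  apply: geometric_delay_sum => // l.
    rewrite -[X in _ <= _ <= X](@level_sum_cst R s p l 1 p1).
    rewrite -[X in X <= _](@level_sum_cst R s p l 0 p1).
    by rewrite !ler_level_sum // => v _; have /andP[] := far01 v.
  rewrite (@eq_level_sum R s p _ _ (fun v => (mis (drop m v))%:R)); last first.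
    by move=> v vl; rewrite /far vl leq_addr.
  rewrite (@level_sum_drop R s p m l (fun v => (mis v)%:R)) //.
  exact: mismatch_level_sum.
apply: (@le_trans _ _ (\sum_(1 <= l < n.+1) (e +
   D * (level_sum p l (fun v => \1_E (foldr br x v)) +
        level_sum p l (fun v => \1_E (foldr br y v)) + level_sum p l far)))).
  apply: ler_sum => l _.
  (* [B] permutes each level preserving weights, so the nodes [B v] of the second tree may be
     averaged as the nodes [v]. *)
  rewrite -(@level_sum_inj R s p l B (fun v => \1_E (foldr br y v)) Binj Bsize Bw).
  rewrite -!level_sumD -level_sumZ.
  rewrite -[X in X + _](@level_sum_cst R s p l e p1) -level_sumD.
  apply: (@ler_level_sum R s p l
    (fun v => mdist (g (foldr br x v)) (g (foldr br y (B v))))) => //.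
rewrite big_split /= lerD2l -mulr_sumr ler_wpM2l // !big_split /=.
rewrite lerD // lerD //.
  by apply: ler_sum => l _; rewrite (branching_level_sum _ _ p0 Grow Gbr Gx).
by apply: ler_sum => l _; rewrite (branching_level_sum _ _ p0 Grow Gbr Gy).
Qed.

(** Each iterate has integral [mu E], so [S] has integral at most [n * eta], and Markov's inequality
    applies at height [n * lambda]. *)
Lemma transfer_sum_markov (R : realType) (N : nat) (A : 'M[R]_N.+1)
    (mu : probability (lseq N) R) (E : set (lseq N)) (lambda eta : R) n :
  (forall i j, 0 <= A i j) -> markov_measure A mu -> measurable E ->
  (mu E <= eta%:E)%E -> 0 < lambda -> (0 < n)%N ->
  let S x := \sum_(1 <= l < n.+1) iter l (transfer A) \1_E x in
  measurable [set x | S x < n%:R * lambda] /\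
  ((1 - eta / lambda)%:E <= mu [set x | (S x < n%:R * lambda)%R])%E.
Proof.
move=> A0 hmu mE muE l0 n0 S.
have it l : [/\ measurable_fun setT (iter l (transfer A) (\1_E : lseq N -> R)),
    forall x, 0 <= iter l (transfer A) (\1_E : lseq N -> R) x
  & (\int[mu]_x (iter l (transfer A) \1_E x)%:E = mu E)%E].
  elim: l => [|l [IHm IH0 IHi]] /=.
    split; [by apply: measurable_indic|by move=> x; rewrite indicE|].
    by rewrite integral_indic // setIT.
  split; [exact: measurable_transfer|by move=> x; exact: transfer_ge0|].
  by rewrite integral_transfer.
have mS : measurable_fun setT S.
  by apply: measurable_sum => l; have [] := it l.
have S0 x : 0 <= S x by apply: sumr_ge0 => l _; have [_ + _] := it l; exact.
have [r mur] : exists r, mu E = r%:E.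
  by exists (fine (mu E)); rewrite fineK // fin_num_measure.
have iS : (\int[mu]_x (S x)%:E = (n%:R * r)%:E)%E.
  under eq_integral do rewrite -sumEFin.
  rewrite ge0_integral_sum //=; last 2 first.
  - by move=> l; apply/measurable_EFinP; have [] := it l.
  - by move=> l x _; rewrite lee_fin; have [_ + _] := it l; exact.
  rewrite (eq_bigr (fun=> r%:E)) => [|l _]; last first.
    by rewrite -mur; have [_ _] := it l.
  by rewrite sumEFin sumr_const_nat subn1 /= mulr_natl.
have n0' : 0 < n%:R :> R by rewrite ltr0n.
have nl0 : 0 < n%:R * lambda by rewrite mulr_gt0.
have mlt : measurable [set x | S x < n%:R * lambda].
  have := mS measurableT _ (measurable_itv `]-oo, (n%:R * lambda)%R[).
  by rewrite setTI; congr measurable; apply/seteqP; split=> x /=; rewrite in_itv.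
split=> //.
(* Markov's inequality, taken with the identity as the monotone function. *)
have := @le_integral_comp_abse _ _ R mu setT measurableT (EFin \o S) (n%:R * lambda)
  id (@measurable_id _ _ setT) (fun _ h => h) (fun _ _ _ _ h => h)
  ((measurable_EFinP _ _).2 mS) nl0.
under eq_integral do rewrite gee0_abs ?lee_fin //.
rewrite [X in (_ <= X)%E]iS setTI.
have -> : [set x | ((n%:R * lambda)%:E <= `|(EFin \o S) x|)%E] =
    ~` [set x | S x < n%:R * lambda].
  apply/seteqP; split=> x /=; rewrite lee_fin ger0_norm // leNgt;
    [by move=> /negP|by move=> h; apply/negP].
rewrite [X in (_ * X <= _)%E](probability_setC mu mlt).
have [b ->] : exists b, mu [set x | S x < n%:R * lambda] = b%:E.
  by exists (fine (mu [set x | S x < n%:R * lambda])); rewrite fineK // fin_num_measure.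
rewrite -EFinB -EFinM !lee_fin -mulrA ler_pM2l // -ler_pdivlMl // => h.
rewrite lerBlDr -lerBlDl (le_trans h) // mulrC ler_pM2r ?invr_gt0 //.
by rewrite -lee_fin -mur.
Qed.

(** * Choice of constants and conclusion *)

Theorem proposition4p1p2 (R : realType) (s : nat) (p : 'I_s -> R) (N : nat)
    (A : 'M[R]_N.+1) (mu : probability (borel (left_sequences N)) R)
    (hp : prob_vector p) (hA : stochastic A) (hirr : irreducible_mx A)
    (hmu : markov_measure A mu)
    (hend : p_endomorphism p mu (@left_shift N))
    (hcol : forall i j, exists k, A i k = A j k /\ A i k != 0) :
  tvwB p mu (@left_shift N).
Proof.
have A0 : forall i j, 0 <= A i j by have [] := hA.
have [p0 _] := hp.
move=> M g cM mg; split; first exact: tree_partition_exists.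
move=> k K hK eps eps0.
have [G0 [mG0 muG0 Grow Gbr]] := conull_row_branching p0 A0 hmu hK.
have [D D0 gD] := compact_diameter cM.
(* Starting the minimum at 1 gives [delta <= 1] directly. *)
pose delta : R := \big[Order.min/1]_a p a.
have d0 : 0 < delta by apply: lt_bigmin.
have d1 : delta <= 1 by exact: bigmin_le_id.
have dp a : delta <= p a by exact: bigmin_le.
(* Three errors are each kept within [e]: the variation of [g], the visits to [E], and the initial
   and mismatched nodes. *)
pose e := eps / 4; have e0 : 0 < e by rewrite divr_gt0.
(* Two visit sums below [n * lambda] cost less than [n * e] together, and bounding [mu E] by
   [eps * lambda] makes Markov's exceptional set have measure at most [eps]. *)
pose lambda := e / D / 2; have l0 : 0 < lambda by rewrite !divr_gt0.
have [m [E [mE muE hE]]] :=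
  almost_local_function mu cM mg e0 (mulr_gt0 eps0 l0).
pose c := D * (m%:R + delta^-1).
(* Beyond this index the bounded cost [c] is less than [n * e]. *)
exists (Num.truncn (c / e)).+1 => n nn0.
have n0 : (0 < n)%N by exact: leq_trans nn0.
have [mH muH] := transfer_sum_markov A0 hmu mE muE l0 n0.
set H := [set x | _] in mH muH.
exists (G0 `&` H); split; first exact: measurableI.
  rewrite mulfK ?gt_eqF // in muH; apply: (le_trans muH).
  (* Intersecting with the conull set [G0] does not reduce the measure of [H]. *)
  have HG : H `<=` (G0 `&` H) `|` ~` G0.
    by move=> x Hx; have [Gx|nGx] := pselect (G0 x); [left|right].
  have mGH : measurable (G0 `&` H) by exact: measurableI.
  have mG0C : measurable (~` G0) by exact: measurableC.
  have mU := measurableU _ _ mGH mG0C.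
  have := le_measure mu (mem_set mH) (mem_set mU) HG; move=> /le_trans; apply.
  by apply: (le_trans (measureU2 _ mGH mG0C)); rewrite [X in (_ + X <= _)%E]muG0 adde0.
move=> x y [Gx Hx] [Gy Hy].
have := @tbar_coupling R s N p A (branch (@left_shift N) k K) G0 M g D e delta
  m E n x y hp hcol Grow Gbr gD e0 hE d0 d1 dp Gx Gy n0.
move=> /le_lt_trans; apply.
move: Hx Hy; rewrite /H /=.
set Sx := \sum_(1 <= l < n.+1) _ => Hx; set Sy := \sum_(1 <= l < n.+1) _ => Hy.
have n0' : 0 < n%:R :> R by rewrite ltr0n.
have cn : c < n%:R * e.
  rewrite -ltr_pdivrMr //; apply: lt_le_trans (truncnS_gt _) _.
  by rewrite ler_nat.
have le2 : D * (n%:R * lambda + n%:R * lambda) = n%:R * e.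
  by rewrite -mulrDr /lambda -splitr mulrCA [D * _]mulrC divfK // gt_eqF.
have epsE : eps = e + (e + (e + e)) by rewrite /e; field.
rewrite [ltRHS]epsE ltrD2l ltr_pdivrMl // [D * _]mulrDr -/c 2![n%:R * (e + _)]mulrDr.
have SxSy : D * (Sx + Sy) < n%:R * e by rewrite -le2 ltr_pM2l // ltrD.
by rewrite ltrD // (lt_trans cn) // ltrDl mulr_gt0.
Qed.
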